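(* Let $X$ be a topological space homeomorphic to a subspace of $C_p(K)$ for some compact Hausdorff space $K$ (an Eberlein-Grothendieck space). If $X$ is a Lindelöf $\Sigma$-space and is scattered, then $X$ is $\sigma$-discrete.
   Context: $C_p(K)$ is the set of all continuous functions $K\to\mathbb{R}$ with the topology of pointwise convergence (inherited from $\mathbb{R}^K$). A Tychonoff space $X$ is a Lindelöf $\Sigma$-space if there are a cover $\mathcal{C}$ of $X$ by compact sets and a countable family $\mathcal{N}$ of subsets of $X$ such that whenever $C\in\mathcal{C}$ and $U$ is an open set containing $C$, there is $N\in\mathcal{N}$ with $C\subset N\subset U$. A space is scattered if every nonempty subspace of it has an isolated point. A space is $\sigma$-discrete if it is the union of countably many subspaces each of which is discrete in its relative topology. *)

(* Defs.v *)
From HB Require Import structures.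
From mathcomp Require Import all_boot all_order all_algebra.
From mathcomp Require Import all_classical all_reals all_analysis.

Set Implicit Arguments.
Unset Strict Implicit.
Unset Printing Implicit Defensive.

Import Order.TTheory GRing.Theory Num.Theory.
Import numFieldNormedType.Exports.

Local Open Scope classical_set_scope.

(* A set [A : set X] used as a type is [set_type A], which carries the relative
   topology (unlike [subspace A], whose carrier is all of [X]). *)

Definition homeomorphic (X Y : topologicalType) : Prop :=
  exists (f : X -> Y) (g : Y -> X),
    [/\ cancel f g, cancel g f, continuous f & continuous g].

Definition Cp (R : realType) (K : topologicalType) : topologicalType :=
  set_type [set f : {ptws K -> R} | continuous (f : K -> R)].

Definition eberlein_grothendieck (R : realType) (X : topologicalType) : Prop :=
  exists K : topologicalType,
    [/\ compact [set: K], hausdorff_space K &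
        exists S : set (Cp R K), homeomorphic X (set_type S)].

Definition tychonoff_space (X : topologicalType) : Prop :=
  completely_regular_space X /\ hausdorff_space X.

Definition lindelof_sigma (X : topologicalType) : Prop :=
  tychonoff_space X /\
  exists (C : set (set X)) (N : set (set X)),
    [/\ \bigcup_(A in C) A = [set: X],
        (forall A, C A -> compact A),
        countable N &
        forall A U, C A -> open U -> A `<=` U ->
          exists2 B, N B & A `<=` B /\ B `<=` U].

Definition scattered (X : topologicalType) : Prop :=
  forall A : set X, A !=set0 -> isolated A !=set0.

Definition relatively_discrete (X : topologicalType) (A : set X) : Prop :=
  forall B : set (set_type A), open B.

Definition sigma_discrete (X : topologicalType) : Prop :=
  exists D : nat -> set X,
    \bigcup_n D n = [set: X] /\ forall n, relatively_discrete (D n).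

(* Main.v *)
Require Import Defs.
From mathcomp Require Import finmap.
From mathcomp Require Import all_boot all_order all_algebra.
From mathcomp Require Import all_classical all_reals all_analysis.
From mathcomp Require Import lra wochoice.

(** Write [e x t] for the value of [x : X] at [t : K].

    A scattered space has a neighbourhood assignment [U] with [x = y] whenever
    [y \in U x] and [x \in U y]. Since [U x] contains a uniform ball, [X] is a
    countable union of uniformly separated sets, so it suffices to find a
    countable-valued code [c] and neighbourhoods [V] such that [c x = c y] and
    [y \in V x] force [x] and [y] to be uniformly close.

    Close [Z], a set of points of [X + K], under countably many finitary
    operations; let [A] and [B] be the parts of the closure in [X] and in [K].
    Finite nets of [K] (compactness) and the countable network (Lindelof Sigma)
    provide operations for which there is a continuous retraction [r Z] of [X]
    onto the topological closure of [A], with [r Z x = x] on the closure of [B].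
    The retractions converge uniformly along increasing families: [r W x] is
    uniformly close to [r Z x] as soon as [W], inside [Z], contains a suitable
    finite set.

    Well-order [X + K] and fix a finite set [F]. For [Z] the union of a
    downclosed set [I] and [F] one proves by well-founded induction on [I] that
    the range of [r Z] is sigma-isolated. If [I] is empty the closure of [Z] is
    countable, and compactness of [K] yields uniform separability. Otherwise,
    let [u] be least such that [r {w <= u}] moves [x] by less than the required
    amount. Then [r {w <= u} x] and [r {w < u} x] are at some positive distance,
    there are only finitely many jumps of [x] of that size, and having a jump at
    a given place is an open condition; fixing the number of jumps and the position
    of [u] among them makes [u] locally constant, and the induction hypothesis
    applies to [r {w <= u} x]. *)

Set Implicit Arguments.
Unset Strict Implicit.
Unset Printing Implicit Defensive.

Import Order.TTheory GRing.Theory Num.Theory.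
Import numFieldNormedType.Exports.

Local Open Scope classical_set_scope.

(** * Well-orders and induction over downclosed sets *)

Section WellOrder.
Context (T : eqType) (R : rel T) (Rwo : well_order R).

Definition initial_segment (v : T) : set T := [set w | R w v /\ w <> v].

Definition downclosed (D : set T) : Prop := forall v w, D v -> R w v -> D w.

Lemma wo_min (A : set T) : A !=set0 -> exists2 z, A z & forall y, A y -> R z y.
Proof.
move=> [x Ax]; have [|z [[Az minz] _]] := Rwo (A := mem A).
  by exists x; exact: mem_set.
exists z; first exact: set_mem.
by move=> y Ay; apply: minz; exact: mem_set.
Qed.

Lemma wo_total x y : R x y \/ R y x.
Proof.
have [|z [->|->] minz] := @wo_min [set x; y]; first by exists x; left.
- by left; apply: minz; right.
- by right; apply: minz; left.
Qed.

Lemma wo_refl x : R x x.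
Proof. by case: (wo_total x x). Qed.

Lemma wo_anti x y : R x y -> R y x -> x = y.
Proof.
move=> xy yx; have [|z [_ uz]] := Rwo (A := mem [set x; y]).
  by exists x; apply: mem_set; left.
have mx a : a = x \/ a = y -> minimum_of R (mem [set x; y]) a.
  by move=> ha; split; [exact: mem_set|move=> b /set_mem[->|->];
    case: ha => ->; rewrite ?wo_refl].
by rewrite -(uz x) ?(uz y) //; apply: mx; [right|left].
Qed.

Lemma wo_trans y x z : R x y -> R y z -> R x z.
Proof.
move=> xy yz; have [|w [[->|->]|->] minw] := @wo_min [set x; y; z].
- by exists x; left; left.
- by apply: minw; right.
- by rewrite (wo_anti xy) //; apply: minw; left; left.
- by rewrite -(wo_anti yz) //; apply: minw; left; right.
Qed.

Lemma downclosed_initial v : downclosed (initial_segment v).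
Proof.
move=> u w [uv neq] wu; split; first exact: wo_trans wu uv.
by move=> wv; apply: neq; apply: wo_anti => //; rewrite -wv.
Qed.

(** The least counterexample is sought among initial segments; a general [D], possibly all of [T],
    takes one more application of [step]. *)
Lemma downclosed_ind (P : set T -> Prop) :
  (forall D, downclosed D -> (forall v, D v -> P (initial_segment v)) -> P D) ->
  forall D, downclosed D -> P D.
Proof.
move=> step; have Pi v : P (initial_segment v).
  apply: contrapT => nPv.
  have [|u nPu minu] := @wo_min [set v | ~ P (initial_segment v)].
    by exists v.
  apply: nPu; apply: step; first exact: downclosed_initial.
  move=> w [wu neq]; apply: contrapT => /minu uw.
  by apply: neq; exact: wo_anti.
by move=> D dD; apply: step.
Qed.

Lemma finite_sub_initial (D F : set T) (l : seq T) :
  D !=set0 -> downclosed D -> [set` l] `<=` D `|` F ->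
  exists2 w, D w & forall v, D v -> R w v -> [set` l] `<=` [set u | R u v] `|` F.
Proof.
move=> [d Dd] dD; elim: l => [_|a l IH sub]; first by exists d.
have [x xl|w Dw wP] := IH.
  by apply: sub; rewrite /= inE; apply/orP; right.
have [Fa|nFa] := pselect (F a).
  exists w => // v Dv wv x; rewrite /= inE => /orP[/eqP->|]; first by right.
  exact: wP.
have Da : D a.
  by have [|//|//] := sub a; rewrite /= inE eqxx.
have [aw|wa] := wo_total a w.
- exists w => // v Dv wv x; rewrite /= inE => /orP[/eqP->|]; last exact: wP.
  by left; exact: wo_trans aw wv.
- exists a => // v Dv av x; rewrite /= inE => /orP[/eqP->|]; first by left.
  by apply: wP => //; exact: wo_trans wa av.
Qed.

End WellOrder.

(** * Closure under countably many finitary partial operations *)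

Section Hull.
Context (S : choiceType) (g : nat -> seq S -> option S).

Inductive hull (Z : set S) : S -> Prop :=
| hull_base s : Z s -> hull Z s
| hull_op n l s : (forall a, a \in l -> hull Z a) -> g n l = Some s -> hull Z s.

Lemma hullS (Z W : set S) : Z `<=` W -> hull Z `<=` hull W.
Proof.
move=> ZW s; elim=> [a Za|n l a _ IH gl]; first exact/hull_base/ZW.
exact: hull_op gl.
Qed.

Lemma hull_finite_seq (Z : set S) (l : seq S) :
  (forall a, a \in l -> hull Z a) ->
  exists2 k : seq S, [set` k] `<=` Z & forall a, a \in l -> hull [set` k] a.
Proof.
have cat_support (l' : seq S) : (forall a, a \in l' -> exists2 k : seq S,
      [set` k] `<=` Z & hull [set` k] a) ->
    exists2 k : seq S, [set` k] `<=` Z & forall a, a \in l' -> hull [set` k] a.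
  elim: l' => [_|a l' IH H]; first by exists [::].
  have [k1 k1Z Pk1] := H a (mem_head _ _).
  have [b bl|k2 k2Z Pk2] := IH; first by apply: H; rewrite inE bl orbT.
  exists (k1 ++ k2).
    by move=> x; rewrite /= mem_cat => /orP[/k1Z|/k2Z].
  move=> b; rewrite inE => /orP[/eqP->|bl].
  - by apply: hullS Pk1 => x /= xk; rewrite mem_cat xk.
  - by apply: hullS (Pk2 _ bl) => x /= xk; rewrite mem_cat xk orbT.
move=> lZ; apply: (cat_support l) => a /lZ; elim=> [b Zb|n k b _ IH gk].
  exists [:: b]; first by move=> x /=; rewrite inE => /eqP->.
  by apply: hull_base; rewrite /= inE.
by have [k' k'Z k'P] := cat_support _ IH; exists k' => //; exact: hull_op gk.
Qed.

(** Each member is the value of a finite tree with positions in [F] at its leaves and operation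
    numbers at its nodes. *)
Lemma countable_hull (F : seq S) : countable (hull [set` F]).
Proof.
pose fix ev (t : GenTree.tree nat) : option S :=
  match t with
  | GenTree.Leaf i => onth F i
  | GenTree.Node n ts => g n (pmap ev ts)
  end.
have evP s : hull [set` F] s -> exists t, ev t = Some s.
  elim=> [a /= aF|n l a _ IH gl].
    by exists (GenTree.Leaf (index a F)); rewrite /= onthE (nth_map a) ?index_mem ?nth_index.
  suff [ts tsl] : exists ts, pmap ev ts = l by exists (GenTree.Node n ts); rewrite /= tsl.
  elim: l {gl} IH => [_|b l IHl IH]; first by exists [::].
  have [t tb] := IH b (mem_head _ _).
  have [c cl|ts tsl] := IHl; first by apply: IH; rewrite inE cl orbT.
  by exists (t :: ts); rewrite /= tb /= tsl.
have /choice[f fP] : forall s, exists t, hull [set` F] s -> ev t = Some s.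
  move=> s; have [/evP[t ts]|n] := pselect (hull [set` F] s); first by exists t.
  by exists (GenTree.Leaf 0%N).
apply/countable_injP; exists (pickle \o f).
move=> x y /set_mem hx /set_mem hy /(pcan_inj pickleK) fxy.
by have := fP _ hx; rewrite fxy fP // => -[].
Qed.

End Hull.

(** * Neighbourhood assignments on scattered spaces *)

Lemma scattered_antisymmetric_nbhs (X : topologicalType) : scattered X ->
  exists U : X -> set X, (forall x, nbhs x (U x)) /\
    forall x y, U x y -> U y x -> x = y.
Proof.
move=> sc.
(* Zorn on graphs of antisymmetric assignments defined on an open set *)
pose good (G : set (X * set X)) :=
  (forall p, G p -> [/\ open p.2, p.2 p.1 & p.2 `<=` [set z | exists V, G (z, V)]]) /\
  (forall p q, G p -> G q -> p.2 q.1 -> q.2 p.1 -> p.1 = q.1).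
have [F Fgood Ftot|G [[G1 G2] Gmax]] := @Zorn_bigcup _ good.
  split.
    move=> p [G FG Gp]; have [gG _] := Fgood _ FG; have [oV Vp sub] := gG _ Gp.
    by split=> // z /sub[V GV]; exists V, G.
  move=> p q [G FG Gp] [H FH Hq].
  have [GH|HG] := Ftot _ _ FG FH.
  - by have [_] := Fgood _ FH; apply=> //; exact: GH.
  - by have [_] := Fgood _ FG; apply=> //; exact: HG.
pose W := [set z | exists V, G (z, V)].
have Wopen : open W.
  rewrite openE => z [V GV]; have [/= oV Vz sV] := G1 _ GV.
  by apply: filterS sV _; exact: open_nbhs_nbhs.
have Wall : W = setT.
  apply: contrapT => nW.
  have [|c [/set_mem cW [N Nc NW]]] := sc (~` W).
    by apply/set0P/eqP => W0; apply: nW; rewrite -(setCK W) W0 setC0.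
  (* As [c] is isolated in the complement of [W], [W'] adds only [c]. Assigning [W'] to [c] keeps
     antisymmetry: the old neighbourhoods stay inside [W], which misses [c]. *)
  pose W' := W `|` N.
  have W'E z : W' z -> W z \/ z = c.
    move=> [|Nz]; first by left.
    have [|nWz] := pselect (W z); first by left.
    by right; have : (N `&` ~` W) z by []; rewrite NW.
  have W'o : open W'.
    rewrite openE => z /W'E[Wz|->].
      by apply: (@filterS _ (nbhs z) _ W); [by left|exact: open_nbhs_nbhs].
    by apply: (@filterS _ (nbhs c) _ N) => //; right.
  have W'c : W' c by right; exact: nbhs_singleton.
  apply: (Gmax (G `|` [set (c, W')])).
    split; first by left.
    move=> /(_ (c, W')) H; apply: cW; exists W'; apply: H; by right.
  split.
    move=> p [Gp|->] /=.
      have [oV Vp sub] := G1 _ Gp; split=> // z /sub[V GV].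
      by exists V; left.
    split=> // z /W'E[[V GV]|->]; first by exists V; left.
    by exists W'; right.
  move=> p q [Gp|->] [Gq|->] //=; first exact: G2.
  - by move=> pc; have [_ _ /(_ _ pc)] := G1 _ Gp.
  - by move=> _ qc; have [_ _ /(_ _ qc)] := G1 _ Gq.
have /choice[U UP] : forall x, exists V, G (x, V).
  by move=> x; have : W x by rewrite Wall.
exists U; split=> [x|x y xy yx].
  by have [/= oU Ux _] := G1 _ (UP x); exact: open_nbhs_nbhs.
exact: (G2 (x, U x) (y, U y)).
Qed.

(** * Finite subcovers and rounding *)

Lemma compact_finite_cover (T : topologicalType) (I : choiceType) (A : set T)
    (D : set I) (f : I -> set T) : compact A ->
  (forall i, D i -> open (f i)) ->
  (forall x, A x -> exists2 i, D i & f i x) ->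
  exists2 l : seq I, [set` l] `<=` D & forall x, A x -> exists2 i, i \in l & f i x.
Proof.
move=> /compact_near_coveringP cA fo Af.
pose F : set_system (seq I) := [set U | exists2 k : seq I, [set` k] `<=` D &
  forall l : seq I, {subset k <= l} -> [set` l] `<=` D -> U l].
have FF : Filter F.
  split; first by exists [::].
  - move=> P Q [k1 k1D Pk1] [k2 k2D Pk2]; exists (k1 ++ k2).
      by move=> i /=; rewrite mem_cat => /orP[/k1D|/k2D].
    move=> l kl lD; split.
    + by apply: Pk1 => // i ik; apply: kl; rewrite mem_cat ik.
    + by apply: Pk2 => // i ik; apply: kl; rewrite mem_cat ik orbT.
  - by move=> P Q PQ [k kD Pk]; exists k => // l kl lD; exact/PQ/Pk.
have [x Ax|k kD kP] := cA _ F (fun l x => exists2 i, i \in l & f i x) FF.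
  have [i Di fix0] := Af x Ax.
  exists (f i, [set l : seq I | i \in l]).
    split; first by apply: open_nbhs_nbhs; split=> //; exact: fo.
    exists [:: i]; first by move=> j /=; rewrite inE => /eqP->.
    by move=> l il _; apply: il; rewrite mem_head.
  by move=> [y l] /= [fy il]; exists i.
by exists k => // x Ax; exact: kP.
Qed.

Lemma near_all_seq (T : Type) (I : eqType) (F : set_system T) (FF : Filter F)
    (l : seq I) (P : I -> T -> Prop) :
  (forall i, i \in l -> F (P i)) -> F [set x | forall i, i \in l -> P i x].
Proof.
elim: l => [_|i l IH H]; first by apply: filterE => x j.
have Fi := H i (mem_head _ _).
have Fl : F [set x | forall i, i \in l -> P i x].
  by apply: IH => j jl; apply: H; rewrite inE jl orbT.
apply: filterS2 Fi Fl => x Pi Pl j; rewrite inE => /orP[/eqP->//|]; exact: Pl.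
Qed.

Lemma map_inj_in (T U : eqType) (f : T -> U) (A : set T) (l k : seq T) :
  {in A &, injective f} -> [set` l] `<=` A -> [set` k] `<=` A ->
  map f l = map f k -> l = k.
Proof.
move=> fi; elim: l k => [|a l IH] [|b k] //= lA kA [fab flk].
have ab : a = b.
  by apply: fi => //; rewrite inE; [apply: lA|apply: kA]; rewrite /= inE eqxx.
rewrite ab (IH k) // => x /= xl; [apply: lA|apply: kA];
  by rewrite /= inE xl orbT.
Qed.

Lemma floor_eq_dist (R : realType) (n : nat) (a b : R) :
  Num.floor (n.+1%:R * a)%R = Num.floor (n.+1%:R * b)%R ->
  (`|a - b| < n.+1%:R^-1)%R.
Proof.
move=> ab; have n0 : (0 < n.+1%:R :> R)%R by rewrite ltr0n.
rewrite -(ltr_pM2l n0) divff ?gt_eqF // -[X in (X * _)%R]gtr0_norm //.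
rewrite -normrM mulrBr.
have := floor_le (n.+1%:R * a)%R; have := floorD1_gt (n.+1%:R * a)%R.
have := floor_le (n.+1%:R * b)%R; have := floorD1_gt (n.+1%:R * b)%R.
rewrite -ab ltr_norml => h1 h2 h3 h4; rewrite !intrD in h1 h3.
by apply/andP; split; lra.
Qed.

Lemma inv_nat_le (R : realType) (n m : nat) : (n <= m)%N ->
  (m.+1%:R^-1 <= n.+1%:R^-1 :> R)%R.
Proof. by move=> nm; rewrite lef_pV2 ?posrE ?ltr0n // ler_nat. Qed.

Lemma inv_nat_lt (R : realType) (c : R) : (0 < c)%R ->
  exists k : nat, (k.+1%:R^-1 < c)%R.
Proof.
move=> c0; exists (Num.truncn c^-1%R).
by rewrite invf_plt ?posrE ?ltr0n // truncnS_gt.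
Qed.

(** * Sigma-discreteness through countable codes *)

Definition sigma_isolated (X : topologicalType) (Y : set X) : Prop :=
  exists (c : X -> nat) (V : X -> set X),
    (forall x, Y x -> nbhs x (V x)) /\
    forall x y, Y x -> Y y -> c x = c y -> V x y -> x = y.

Lemma sigma_isolated_countType (X : topologicalType) (T : countType) (Y : set X)
    (c : X -> T) (V : X -> set X) :
  (forall x, Y x -> nbhs x (V x)) ->
  (forall x y, Y x -> Y y -> c x = c y -> V x y -> x = y) -> sigma_isolated Y.
Proof.
move=> nV cV; exists (pickle \o c), V; split=> // x y Yx Yy.
by move=> /(pcan_inj pickleK); exact: cV.
Qed.

Lemma sigma_isolated_discrete (X : topologicalType) :
  sigma_isolated [set: X] -> sigma_discrete X.
Proof.
move=> [c [V [nV cV]]]; exists (fun n => c @^-1` [set n]); split.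
  by apply/seteqP; split=> // x _; exists (c x).
move=> n B; rewrite openE => -[x cx] Bx.
have := nV x I; rewrite nbhsE => -[W [oW Wx] WV].
exists (set_val @^-1` W); split; [by exists W|by []|].
move=> [y cy] /= Wy; suff yx : y = x.
  by move: cy Wy; rewrite yx => cy _; rewrite (Prop_irrelevance cy cx).
apply/esym; apply: cV => //; last exact: WV.
by rewrite (set_mem cx : c x = n) (set_mem cy : c y = n).
Qed.

Local Open Scope ring_scope.

(** * Finite approximation for pointwise convergence on a compact space *)

Section Pairing.
Context (R : realType) (X K : topologicalType) (e : X -> K -> R).
Context (cK : compact [set: K]).
Context (ce : forall x, continuous (e x)) (ce' : forall t, continuous (e^~ t)).
Context (initial : forall (F : set_system X) (FF : Filter F) x,
  (forall t, (e^~ t) @ F --> e x t) -> F --> x).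
Context (e_inj : forall x y, e x =1 e y -> x = y).

Lemma open_lt_dist (T : topologicalType) (f h : T -> R) (c : R) :
  continuous f -> continuous h -> open [set t | c < `|f t - h t|].
Proof.
move=> cf ch; apply: (open_comp (f := fun t => `|f t - h t|) (D := [set y | c < y])).
  by move=> t _; apply: cvg_norm; exact: cvgB (cf t) (ch t).
exact: open_gt.
Qed.

Lemma open_dist_lt (T : topologicalType) (f h : T -> R) (c : R) :
  continuous f -> continuous h -> open [set t | `|f t - h t| < c].
Proof.
move=> cf ch; apply: (open_comp (f := fun t => `|f t - h t|) (D := [set y | y < c])).
  by move=> t _; apply: cvg_norm; exact: cvgB (cf t) (ch t).
exact: open_lt.
Qed.

Lemma closure_approx (A : set X) x (l : seq K) (eps : R) : closure A x -> 0 < eps ->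
  exists2 a, A a & forall t, t \in l -> `|e a t - e x t| < eps.
Proof.
move=> Ax e0; have [|a [Aa aP]] := Ax [set a | forall t, t \in l -> `|e a t - e x t| < eps].
  apply: near_all_seq => t _; apply: open_nbhs_nbhs; split.
    by apply: open_dist_lt; [exact: ce'|exact: cst_continuous].
  by rewrite /= subrr normr0.
by exists a.
Qed.

(** The pairs where [x] varies by at least [eps] form a compact set. A member of [A] within
    [eps / 4] of [x] at both points of such a pair varies there by more than [eps / 2], so finitely
    many members separate all these pairs. *)
Lemma closure_separation (A : set X) x (eps : R) : closure A x -> 0 < eps ->
  exists2 l : seq X, [set` l] `<=` A & forall u v,
    (forall a, a \in l -> `|e a u - e a v| <= eps / 4) -> `|e x u - e x v| < eps.
Proof.
move=> Ax e0.
have cf z : continuous (fun p : K * K => e z p.1).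
  by move=> p; apply: (@continuous_comp _ _ _ fst (e z)); [exact: cvg_fst|exact: ce].
have cg z : continuous (fun p : K * K => e z p.2).
  by move=> p; apply: (@continuous_comp _ _ _ snd (e z)); [exact: cvg_snd|exact: ce].
pose E := [set p : K * K | eps <= `|e x p.1 - e x p.2|].
have cE : compact E.
  apply: (@subclosed_compact _ _ ([set: K] `*` [set: K])) => //.
    rewrite -[E]setCK; apply: open_closedC.
    suff -> : ~` E = [set p : K * K | `|e x p.1 - e x p.2| < eps] by exact: open_dist_lt.
    by apply/seteqP; split=> p; rewrite /E /= ltNge => /negP.
  exact: compact_setX.
have [||l lA lP] := @compact_finite_cover _ _ E A
  (fun a => [set p : K * K | eps / 4 < `|e a p.1 - e a p.2|]) cE.
- by move=> a _; exact: open_lt_dist.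
- move=> [u v] /= Euv.
  have e4 : 0 < eps / 4 by rewrite divr_gt0.
  have [a Aa aP] := closure_approx [:: u; v] Ax e4.
  exists a => //=; move: (aP u) (aP v); rewrite !inE !eqxx ?orbT /= => /(_ isT) h1 /(_ isT) h2.
  move: Euv; rewrite /E /= => h3.
  have := ler_distD (e a u) (e x u) (e x v); have := ler_distD (e a v) (e a u) (e x v).
  by rewrite (distrC (e x u) (e a u)); lra.
- exists l => // u v luv; rewrite ltNge; apply/negP => /(lP (u, v))[a al /=].
  by rewrite ltNge luv.
Qed.

Lemma finite_net (k : nat) (l : seq X) :
  exists r : seq K, forall t, exists2 t0, t0 \in r &
    forall a, a \in l -> `|e a t - e a t0| < k.+1%:R^-1.
Proof.
have [||r _ rP] := @compact_finite_cover _ K [set: K] [set: K]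
  (fun t0 => [set t | forall a, a \in l -> `|e a t - e a t0| < k.+1%:R^-1]) cK.
- move=> t0 _; rewrite openE => t tP; apply: near_all_seq => a al.
  apply: open_nbhs_nbhs; split; last exact: tP.
  by apply: open_dist_lt => //; exact: cst_continuous.
- by move=> t _; exists t => // a _ /=; rewrite subrr normr0.
by exists r => t; exact: rP.
Qed.

Lemma sup_ball_nbhs x (U : set X) : nbhs x U ->
  exists n : nat, forall y, (forall t, `|e y t - e x t| < n.+1%:R^-1) -> U y.
Proof.
pose F : set_system X := [set W | exists n : nat,
  forall y, (forall t, `|e y t - e x t| < n.+1%:R^-1) -> W y].
have FF : Filter F.
  split; first by exists 0%N.
  - move=> P Q [n nP] [m mQ]; exists (maxn n m) => y yP; split.
    + by apply: nP => t; apply: lt_le_trans (yP t) _; apply: inv_nat_le; exact: leq_maxl.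
    + by apply: mQ => t; apply: lt_le_trans (yP t) _; apply: inv_nat_le; exact: leq_maxr.
  - by move=> P Q PQ [n nP]; exists n => y /nP /PQ.
apply: (initial FF) => t; apply/cvgrPdist_lt => eps e0.
have [n ne] := inv_nat_lt e0.
by exists n => y /(_ t) yt; rewrite distrC; exact: lt_trans yt ne.
Qed.

(** Points with equal [m] use balls of one radius, so closeness puts each in the neighbourhood of
    the other. *)
Lemma scattered_norm_separated : scattered X ->
  exists m : X -> nat, forall x y, m x = m y ->
    (forall t, `|e x t - e y t| < (m x).+1%:R^-1) -> x = y.
Proof.
move=> /scattered_antisymmetric_nbhs[U [nU Ua]].
have /choice[m mP] := fun x => sup_ball_nbhs (nU x).
exists m => x y mxy xy; apply: Ua; apply: mP => t; last by rewrite -mxy.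
by rewrite distrC.
Qed.


(** * Retractions onto closures of hulls *)

Definition is_retraction (A : set X) (B : set K) (r : X -> X) : Prop :=
  [/\ continuous r, forall x, closure A (r x),
      forall x t, closure B t -> e (r x) t = e x t,
      forall x, closure A x -> r x = x &
      forall t, exists2 t', closure B t' & forall z, closure A z -> e z t' = e z t].

Lemma closure_eq_eval (A : set X) t t' : (forall a, A a -> e a t' = e a t) ->
  forall z, closure A z -> e z t' = e z t.
Proof.
move=> At z Az; apply/eqP; rewrite -subr_eq0 -normr_eq0; apply/negPn/negP => n0.
have d0 : 0 < `|e z t' - e z t| by rewrite lt_neqAle eq_sym n0 normr_ge0.
have [l lA lP] := closure_separation Az d0.
suff : `|e z t' - e z t| < `|e z t' - e z t| by rewrite ltxx.
by apply: lP => a al; rewrite At ?subrr ?normr0 ?divr_ge0 //; exact: lA.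
Qed.

Lemma closure_eq_eval2 (B : set K) x y : (forall b, B b -> e x b = e y b) ->
  forall t, closure B t -> e x t = e y t.
Proof.
move=> Bxy t Bt; apply/eqP; rewrite -subr_eq0 -normr_eq0; apply/negPn/negP => n0.
have d0 : 0 < `|e x t - e y t| by rewrite lt_neqAle eq_sym n0 normr_ge0.
have [|b [Bb]] := Bt [set s | 0 < `|e x s - e y s|].
  by apply: open_nbhs_nbhs; split=> //; exact: open_lt_dist.
by rewrite /= (Bxy _ Bb) subrr normr0 ltxx.
Qed.

(** The coordinate of [r] at [t] is the evaluation at a representative [t'] of [t] in [closure B];
    hence [r] is continuous. *)
Lemma retraction_exists (A : set X) (B : set K) :
  (forall x, exists2 y, closure A y & forall b, B b -> e y b = e x b) ->
  (forall t, exists2 t', closure B t' & forall a, A a -> e a t' = e a t) ->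
  exists r, is_retraction A B r.
Proof.
move=> G1 G2.
have /choice[r rP] : forall x, exists y,
    closure A y /\ forall b, B b -> e y b = e x b.
  by move=> x; have [y] := G1 x; exists y.
have G2c t : exists2 t', closure B t' & forall z, closure A z -> e z t' = e z t.
  by have [t' Bt' At'] := G2 t; exists t' => //; exact: closure_eq_eval.
have rB x t : closure B t -> e (r x) t = e x t.
  by apply: closure_eq_eval2; exact: (rP x).2.
have rA x : closure A (r x) by exact: (rP x).1.
exists r; split => // [x|x Ax].
  apply: (@initial (r @ x) _ (r x)) => t; have [t' Bt' tP] := G2c t.
  have E : (e^~ t) \o r = e^~ t' by apply/funext => y /=; rewrite -tP // rB.
  by change (((e^~ t) \o r) @ x --> ((e^~ t) \o r) x); rewrite E; exact: ce'.
apply: e_inj => t; have [t' Bt' tP] := G2c t.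
by rewrite -tP // rB // tP.
Qed.

Let S : choiceType := (X + K)%type.

Let points (Z : set S) : set X := [set x | Z (inl x)].
Let indices (Z : set S) : set K := [set t | Z (inr t)].

(** Since [x] and [t] need not lie in the hull, they enter an operation only through countable data:
    the rounded values of [x] on [l], and the position of [t0] in a finite net. *)
Lemma closing_operations (N : nat -> set X) :
  exists g : nat -> seq S -> option S, forall Z,
    (forall i k (l : seq K) x, [set` l] `<=` indices (hull g Z) -> N i x ->
      exists2 y, points (hull g Z) y /\ N i y &
        forall t, t \in l -> `|e y t - e x t| < k.+1%:R^-1) /\
    (forall k (l : seq X) t, [set` l] `<=` points (hull g Z) ->
      exists2 t0, indices (hull g Z) t0 &
        forall a, a \in l -> `|e a t - e a t0| < k.+1%:R^-1).
Proof.
have /choice[net netP] : forall kl : nat * seq X, exists r : seq K,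
    forall t, exists2 t0, t0 \in r &
      forall a, a \in kl.2 -> `|e a t - e a t0| < kl.1.+1%:R^-1.
  by move=> [k l]; exact: finite_net.
(* the code of an operation records a member of the network, a precision and
   the rounded values to be realised on the given indices *)
pose code k y (l : seq K) := [seq Num.floor (k.+1%:R * e y t) | t <- l].
have /choice[sel selP] : forall p : nat * nat * seq int * seq K, exists y : option X,
    forall x, N p.1.1.1 x -> code p.1.1.2 x p.2 = p.1.2 ->
      exists2 z, y = Some z & N p.1.1.1 z /\ code p.1.1.2 z p.2 = p.1.2.
  move=> [[[i k] c] l] /=.
  have [[x [Nx cx]]|nx] := pselect (exists x, N i x /\ code k x l = c).
    by exists (Some x) => y _ _; exists x.
  by exists None => x Nx cx; exfalso; apply: nx; exists x.
pose getX (s : S) := if s is inl x then Some x else None.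
pose getK (s : S) := if s is inr t then Some t else None.
have getXK l : pmap getX [seq inl x | x <- l] = l.
  by elim: l => //= a l ->.
have getKK l : pmap getK [seq inr x | x <- l] = l.
  by elim: l => //= a l ->.
pose g n (l : seq S) : option S :=
  match unpickle n : option ((nat * nat * seq int) + (nat * nat)) with
  | Some (inl p) => omap inl (sel (p, pmap getK l))
  | Some (inr p) => omap inr (onth (net (p.1, pmap getX l)) p.2)
  | None => None
  end.
exists g => Z; split.
- move=> i k l x lB Nx.
  have [y selE [Ny cy]] := selP (i, k, code k x l, l) x Nx erefl.
  exists y.
    split=> //; apply: (@hull_op _ _ _ (pickle (inl (i, k, code k x l)
      : (nat * nat * seq int) + (nat * nat))) [seq inr t | t <- l]).
      by move=> a /mapP[t tl ->]; exact: lB.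
    by rewrite /g pickleK /= getKK selE.
  move=> t tl; apply: floor_eq_dist.
  by move/eq_in_map: cy => /(_ t tl).
- move=> k l t lA; have [t0 t0r t0P] := netP (k, l) t.
  exists t0 => //; apply: (@hull_op _ _ _ (pickle (inr (k, index t0 (net (k, l)))
      : (nat * nat * seq int) + (nat * nat))) [seq inl a | a <- l]).
    by move=> a /mapP[b bl ->]; exact: lA.
  by rewrite /g pickleK /= getXK onthE (nth_map t0) ?index_mem // nth_index.
Qed.

Lemma lindelof_sigma_retractions : lindelof_sigma X ->
  exists (g : nat -> seq S -> option S) (r : set S -> X -> X),
    forall Z, is_retraction (points (hull g Z)) (indices (hull g Z)) (r Z).
Proof.
move=> [_ [C [N0 [Ccov Ccpt N0count N0net]]]].
have /countable_injP[f f_inj] := N0count.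
pose N i : set X := [set x | exists2 M, N0 M /\ f M = i & M x].
have [g gP] := closing_operations N; exists g.
suff /choice[r rP] : forall Z, exists r,
    is_retraction (points (hull g Z)) (indices (hull g Z)) r by exists r.
move=> Z.
have [g1 g2] := gP Z; move: g1 g2.
set A := points _; set B := indices _ => g1 g2.
have maxk (T : eqType) (l : seq (T * nat)) :
    exists m, forall p, p \in l -> (p.2 <= m)%N.
  elim: l => [|p l [m mP]]; first by exists 0%N.
  exists (maxn p.2 m) => q; rewrite inE => /orP[/eqP->|/mP qm]; first exact: leq_maxl.
  exact: leq_trans qm (leq_maxr _ _).
apply: retraction_exists.
- move=> x; have [D CD Dx] : (\bigcup_(A in C) A) x by rewrite Ccov.
  apply: contrapT => nx.
  (* A bad open set contains no point of [A] approximating [x] at given indices to a given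
     precision. If no [y] fits, bad sets cover the compact [D]; a network member between [D] and a
     finite subcover then yields a point of [A] meeting all these precisions, a contradiction. *)
  pose bad (p : set X * seq K * nat) := [/\ open p.1.1, [set` p.1.2] `<=` B &
    forall y, A y -> p.1.1 y -> ~ forall t, t \in p.1.2 -> `|e y t - e x t| < p.2.+1%:R^-1].
  have [p []//|d Dd|l lbad lP] :=
      @compact_finite_cover _ _ D bad (fun p => p.1.1) (Ccpt _ CD).
    have [Ad|nAd] := pselect (closure A d).
      have [b Bb ndb] : exists2 b, B b & e d b <> e x b.
        apply: contrapT => H; apply: nx; exists d => // b Bb.
        by apply: contrapT => nb; apply: H; exists b.
      have d0 : 0 < `|e d b - e x b| by rewrite normr_gt0 subr_eq0; exact/eqP.
      have [k kP] := inv_nat_lt d0.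
      exists ([set y | k.+1%:R^-1 < `|e y b - e x b|], [:: b], k) => //.
      split => /=.
      + by apply: open_lt_dist; [exact: ce'|exact: cst_continuous].
      + by move=> t /=; rewrite inE => /eqP->.
      + by move=> y _ /ltW yb /(_ b); rewrite mem_head ltNge yb => /(_ isT).
    exists (~` closure A, [::], 0%N) => //; split => //=.
      by apply: closed_openC; exact: closed_closure.
    by move=> y Ay + _; apply; exact: subset_closure.
  pose U := \bigcup_(p in [set` l]) p.1.1.
  have [M N0M [DM MU]] : exists2 M, N0 M & D `<=` M /\ M `<=` U.
    have oU : open U by apply: bigcup_open => p /lbad[].
    have DU : D `<=` U by move=> d Dd; have [p pl pd] := lP d Dd; exists p.
    exact: N0net CD oU DU.
  have [m mP] := maxk _ l.
  have [||y [Ay [M' [N0M' fM'] M'y]] yP] :=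
      g1 (f M) m (flatten [seq p.1.2 | p <- l]) x.
  + move=> t /= /flattenP[_ /mapP[p pl ->]] tp.
    by have [_ sB _] := lbad _ pl; exact: sB.
  + by exists M => //; exact: DM.
  have M'M : M' = M by apply: f_inj; rewrite ?inE.
  have [p pl py] : U y by apply: MU; rewrite -M'M.
  have [_ _ H] := lbad _ pl; apply: (H y Ay py) => t tp.
  apply: lt_le_trans (inv_nat_le R (mP _ pl)); apply: yP.
  by apply/flattenP; exists p.1.2 => //; exact: map_f.
(* By compactness of [closure B], finitely many members of [A] tell [t] from all its points at a
   common precision, which the net operation beats. *)
- move=> t; apply: contrapT => nt.
  have cB : compact (closure B).
    by apply: (subclosed_compact _ cK) => //; exact: closed_closure.
  have [[a k] _|t' Bt'|l lA lP] := @compact_finite_cover _ _ (closure B)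
      [set p : X * nat | A p.1]
      (fun p => [set t' | p.2.+1%:R^-1 < `|e p.1 t - e p.1 t'|]) cB.
  + by apply: open_lt_dist; [exact: cst_continuous|exact: ce].
  + have [a Aa na] : exists2 a, A a & e a t' <> e a t.
      apply: contrapT => H; apply: nt; exists t' => // a Aa.
      by apply: contrapT => na; apply: H; exists a.
    have [|k kP] := @inv_nat_lt _ `|e a t - e a t'|; last by exists (a, k).
    by rewrite normr_gt0 subr_eq0 eq_sym; exact/eqP.
  + have [m mP] := maxk _ l.
    have [|t0 Bt0 t0P] := g2 m [seq p.1 | p <- l] t.
      by move=> a /= /mapP[p pl ->]; exact: lA.
    have [p pl /=] := lP t0 (subset_closure Bt0).
    apply/negP; rewrite -leNgt ltW //; apply: lt_le_trans (inv_nat_le R (mP _ pl)).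
    by apply: t0P; exact: map_f.
Qed.

(** * Convergence of the retractions and the countable case *)

Section Induction.
Context (g : nat -> seq S -> option S) (r : set S -> X -> X).
Context (rP : forall Z,
  is_retraction (points (hull g Z)) (indices (hull g Z)) (r Z)).
Context (m : X -> nat) (mP : forall x y, m x = m y ->
  (forall t, `|e x t - e y t| < (m x).+1%:R^-1) -> x = y).
Context (L : rel S) (Lwo : well_order L).

Let Y (Z : set S) : set X := closure (points (hull g Z)).

(** Finitely many hull points control the oscillation of [r Z x] and have a finite support in [Z].
    If [W] contains it, [t] has a representative [u] for [W] that these points cannot tell from [t],
    and both retractions agree with [x] at [u]. *)
Lemma retraction_approx (Z : set S) x (eps : R) : 0 < eps ->
  exists2 l : seq S, [set` l] `<=` Z & forall W, [set` l] `<=` W -> W `<=` Z ->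
    forall t, `|e (r W x) t - e (r Z x) t| < eps.
Proof.
move=> e0; have [_ rA rB _ _] := rP Z.
have [l lA lP] := closure_separation (rA x) e0.
have [|k kZ kP] := @hull_finite_seq _ g Z [seq inl a | a <- l].
  by move=> _ /mapP[a al ->]; exact: lA.
exists k => // W kW WZ t; have [_ rWA rWB _ rWt] := rP W.
have [u Wu uP] := rWt t.
have Zu : closure (indices (hull g Z)) u.
  by move: Wu; apply: closure_subset => v; exact: hullS.
rewrite -uP // rWB // -rB //; apply: lP => a al.
rewrite uP ?subrr ?normr0 ?divr_ge0 ?ltW //; apply: subset_closure.
by apply: (hullS kW); apply: kP; exact: map_f.
Qed.

Lemma sigma_isolated_countable (A : set X) : countable A ->
  sigma_isolated (closure A).
Proof.
move=> /countable_injP[f f_inj].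
have /choice[net netP] : forall kl : nat * seq X, exists s : seq K,
    forall t, exists2 t0, t0 \in s &
      forall a, a \in kl.2 -> `|e a t - e a t0| < kl.1.+1%:R^-1.
  by move=> [k l]; exact: finite_net.
(* With [d = 1 / (m x + 1)], the comparison of [x] and [y] at [t] goes to a net point [t0], across,
   and back, at cost [d / 3] each. Separation at [d / 3] asks for a net of precision [d / 12]. *)
pose prec x := (12 * (m x).+1)%N.
have precE x : (prec x).+1%:R^-1 <= (m x).+1%:R^-1 / 3 / 4 :> R.
  rewrite -!invfM lef_pV2 ?posrE ?mulr_gt0 ?ltr0n //.
  by rewrite -!natrM ler_nat /prec (mulnC 12) -mulnA.
have prec3 x : (3 * (m x).+1).-1.+1%:R^-1 = (m x).+1%:R^-1 / 3 :> R.
  by rewrite prednK // mulnC natrM invfM.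
have /choice[l lP] : forall x, exists l : seq X, closure A x ->
    [set` l] `<=` A /\ forall u v, (forall a, a \in l ->
      `|e a u - e a v| <= (m x).+1%:R^-1 / 3 / 4) ->
    `|e x u - e x v| < (m x).+1%:R^-1 / 3.
  move=> x; have [Ax|nAx] := pselect (closure A x); last by exists [::].
  have [|l lA lP] := closure_separation (eps := (m x).+1%:R^-1 / 3) Ax.
    by rewrite divr_gt0 // invr_gt0 ltr0n.
  by exists l.
pose c x := (m x, map f (l x), [seq Num.floor ((3 * (m x).+1).-1.+1%:R * e x t)
  | t <- net (prec x, l x)]).
apply: (@sigma_isolated_countType _ _ _ c (fun=> setT)).
  by move=> x _; exact: filterT.
move=> x y Ax Ay [mxy flxy] cxy _.
have [lxA lxP] := lP x Ax; have [lyA lyP] := lP y Ay.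
have lxy : l x = l y by exact: map_inj_in f_inj lxA lyA flxy.
apply: mP => // t; have [t0 t0n t0P] := netP (prec x, l x) t.
have close a : a \in l x -> `|e a t - e a t0| <= (m x).+1%:R^-1 / 3 / 4.
  by move=> al; apply: le_trans (precE x); apply: ltW; exact: t0P.
have h1 := lxP t t0 close.
have h2 : `|e y t - e y t0| < (m x).+1%:R^-1 / 3.
  by rewrite mxy; apply: lyP => a; rewrite -lxy -mxy; exact: close.
have h3 : `|e x t0 - e y t0| < (m x).+1%:R^-1 / 3.
  rewrite -prec3; apply: floor_eq_dist.
  move: cxy; rewrite /prec -mxy -lxy => /eq_in_map; exact.
have := ler_distD (e x t0) (e x t) (e y t); have := ler_distD (e y t0) (e x t0) (e y t).
rewrite (distrC (e y t0) (e y t)); move: h1 h2 h3.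
by move: (m x).+1%:R^-1 => d; lra.
Qed.

(** * Jumps of the retractions along the well-order *)

Section Step.
Context (F : seq S).

Let lo (u : S) : set S := initial_segment L u `|` [set` F].
Let hi (u : S) : set S := [set w | L w u] `|` [set` F].

(** The least element counts as a jump of every size: nothing below it can contradict minimality in
    [jump_exists]. *)
Definition jump k x (u : S) : Prop := (forall v, ~ initial_segment L u v) \/
  exists t, k.+1%:R^-1 < `|e (r (hi u) x) t - e (r (lo u) x) t|.

(** Above some [w] in [D], both retractions at [v] lie within half the jump size of the one for [D]
    with [F], so no jump occurs; below [w] the induction hypothesis applies. *)
Lemma finite_jumps k x (D : set S) : downclosed L D -> finite_set (jump k x `&` D).
Proof.
move: D; apply: (downclosed_ind Lwo) => D dD IH.
have [->|/set0P D0] := eqVneq D set0; first by rewrite setI0.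
have e0 : 0 < k.+1%:R^-1 / 2 :> R by rewrite divr_gt0 // invr_gt0 ltr0n.
have [l lZ lP] := retraction_approx (D `|` [set` F]) x e0.
have [w Dw wP] := finite_sub_initial Lwo D0 dD lZ.
apply: (@sub_finite_set _ _ ((jump k x `&` initial_segment L w) `|` [set w])); last first.
  by rewrite finite_setU; split; [exact: IH|exact: finite_set1].
move=> v [Jv Dv].
have [->|/eqP vw] := eqVneq v w; first by right.
have [Lvw|Lwv] := wo_total Lwo v w; first by left.
exfalso; case: Jv => [/(_ w)|[t]]; first by apply; split=> // wv; apply: vw.
have hl : [set` l] `<=` hi v by exact: wP.
have hZ : hi v `<=` D `|` [set` F].
  by move=> z [zv|zF]; [left; exact: dD zv|right].
have ll : [set` l] `<=` lo v.
  move=> z /(wP w Dw (wo_refl Lwo w))[zw|zF]; last by right.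
  left; split; first exact: (wo_trans Lwo) zw Lwv.
  by move=> zv; apply: vw; apply: (wo_anti Lwo) => //; rewrite -zv.
have lZ' : lo v `<=` D `|` [set` F] by move=> z [[zv _]|zF]; apply: hZ; [left|right].
have := lP _ hl hZ t; have := lP _ ll lZ' t.
have := ler_distD (e (r (D `|` [set` F]) x) t) (e (r (hi v) x) t) (e (r (lo v) x) t).
rewrite (distrC (e (r (D `|` [set` F]) x) t) (e (r (lo v) x) t)).
by move: k.+1%:R^-1 => d h1 h2 h3 h4; lra.
Qed.

Lemma jump_exists (I : set S) x : downclosed L I -> I !=set0 ->
  Y (I `|` [set` F]) x ->
  exists u k, [/\ I u, jump k x u &
    forall t, `|e (r (hi u) x) t - e x t| < (m x).+1%:R^-1 / 2].
Proof.
move=> dI I0 Yx; set d := (m x).+1%:R^-1 / 2.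
have d0 : 0 < d by rewrite divr_gt0 // invr_gt0 ltr0n.
(* A uniform bound [q] strictly below [d] leaves the gap from which the jump size is taken. *)
pose close Z := exists2 q, q < d & forall t, `|e (r Z x) t - e x t| <= q.
have sub_hi (D : set S) eps : downclosed L D -> D !=set0 -> 0 < eps ->
    exists2 w, D w & forall t, `|e (r (hi w) x) t - e (r (D `|` [set` F]) x) t| < eps.
  move=> dD D0 e0; have [l lZ lP] := retraction_approx (D `|` [set` F]) x e0.
  have [w Dw wP] := finite_sub_initial Lwo D0 dD lZ.
  exists w => //; apply: lP; first by apply: wP => //; exact: wo_refl.
  by move=> z [zw|zF]; [left; exact: dD zw|right].
have [u [Iu [q qd uq]] umin] : exists2 u, I u /\ close (hi u) &
    forall v, I v /\ close (hi v) -> L u v.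
  apply: (wo_min Lwo); have [|w Iw wP] := sub_hi I (d / 2) dI I0.
    by rewrite divr_gt0.
  exists w; split=> //; exists (d / 2); first by lra.
  have [_ _ _ rfix _] := rP (I `|` [set` F]).
  by move=> t; have := wP t; rewrite rfix // => /ltW.
have uP t : `|e (r (hi u) x) t - e x t| < d by exact: le_lt_trans (uq t) qd.
have [u0|/set0P u0] := eqVneq (initial_segment L u) set0.
  exists u, 0%N; split=> //; left=> v uv.
  by have : set0 v by rewrite -u0.
(* If [lo u] stayed within [q'], some [hi w] with [w] below [u] would be close, against minimality;
   so the jump at [u] exceeds [q' - q]. *)
pose q' := (q + d) / 2.
have [t tP] : exists t, q' < `|e (r (lo u) x) t - e x t|.
  apply: contrapT => H.
  have lo_near t : `|e (r (lo u) x) t - e x t| <= q'.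
    by rewrite leNgt; apply/negP => ?; apply: H; exists t.
  have [|w [wu nwu] wP] := sub_hi (initial_segment L u) ((d - q') / 2)
      (downclosed_initial Lwo (v := u)) u0; first by rewrite /q'; lra.
  apply: nwu; apply: (wo_anti Lwo) => //; apply: umin; split; first exact: dI wu.
  exists ((q' + d) / 2); first by rewrite /q'; lra.
  move=> t; have := wP t; have := lo_near t.
  by have := ler_distD (e (r (lo u) x) t) (e (r (hi w) x) t) (e x t); rewrite -/(lo u); lra.
have [|k kP] := @inv_nat_lt _ (q' - q); first by rewrite /q'; lra.
exists u, k; split=> //; right; exists t; apply: lt_trans kP _.
have := ler_distD (e (r (hi u) x) t) (e (r (lo u) x) t) (e x t).
by rewrite (distrC (e (r (lo u) x) t) (e (r (hi u) x) t)); have := uq t; lra.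
Qed.

Lemma near_jump k x u : jump k x u -> \forall y \near x, jump k y u.
Proof.
case=> [u0|[t tP]]; first by apply: filterE => y; left.
have cr Z : continuous (fun y => e (r Z y) t).
  move=> y; apply: (@continuous_comp _ _ _ (r Z) (e^~ t)); last exact: ce'.
  by have [+ _ _ _ _] := rP Z; apply.
apply: (@filterS _ _ _ [set y | k.+1%:R^-1 < `|e (r (hi u) y) t - e (r (lo u) y) t|]).
  by move=> y ty; right; exists t.
by apply: open_nbhs_nbhs; split=> //; exact: open_lt_dist.
Qed.

(** [V x] preserves the finitely many jumps of [x], so equal cardinality forces [J x = J y], and the
    position gives one [u]. The code for [hi u] then identifies the retracted points, each within
    half the separation radius of its original. *)
Lemma sigma_isolated_step (I : set S) : downclosed L I -> I !=set0 ->
  (forall u, I u -> sigma_isolated (Y (hi u))) ->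
  sigma_isolated (Y (I `|` [set` F])).
Proof.
move=> dI I0 IH; set Z := I `|` [set` F].
have /choice[cV cVP] : forall u, exists cV : (X -> nat) * (X -> set X), I u ->
    (forall x, Y (hi u) x -> nbhs x (cV.2 x)) /\
    forall x y, Y (hi u) x -> Y (hi u) y -> cV.1 x = cV.1 y -> cV.2 x y -> x = y.
  move=> u; have [/IH[c [V H]]|nIu] := pselect (I u); first by exists (c, V).
  by exists (fun=> 0%N, fun=> setT).
have [i0 _] := I0.
have /choice[uk ukP] : forall x, exists uk : S * nat, Y Z x ->
    [/\ I uk.1, jump uk.2 x uk.1 &
    forall t, `|e (r (hi uk.1) x) t - e x t| < (m x).+1%:R^-1 / 2].
  move=> x; have [/(jump_exists dI I0)[u [k H]]|nY] := pselect (Y Z x).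
    by exists (u, k).
  by exists (i0, 0%N).
pose J x := fset_set (jump (uk x).2 x `&` I).
pose c x := (m x, (uk x).2, #|` J x|%fset, index (uk x).1 (J x),
  (cV (uk x).1).1 (r (hi (uk x).1) x)).
pose V x := [set y | (forall v, v \in (J x : seq S) -> jump (uk x).2 y v) /\
  (cV (uk x).1).2 (r (hi (uk x).1) x) (r (hi (uk x).1) y)].
have JE x v : (v \in J x) = (v \in jump (uk x).2 x `&` I).
  by rewrite in_fset_set //; exact: finite_jumps.
have rY u x : Y (hi u) (r (hi u) x) by have [_ + _ _ _] := rP (hi u); apply.
apply: (@sigma_isolated_countType _ _ _ c V).
  move=> x Yx; have [Iu Ju uP] := ukP x Yx.
  apply: filterI.
    apply: near_all_seq => v vJ; apply: near_jump.
    by have : v \in J x by []; rewrite JE => /set_mem[].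
  have [cr _ _ _ _] := rP (hi (uk x).1).
  by apply: (cr x); have [nV _] := cVP _ Iu; exact: nV.
move=> x y Yx Yy [mxy kxy Jc ic cc] [VJ Vr].
have [Iu Ju uP] := ukP x Yx; have [Iu' Ju' uP'] := ukP y Yy.
have JJ : J x = J y.
  apply/eqP; rewrite eqEfcard Jc leqnn andbT; apply/fsubsetP => v vJ.
  rewrite JE; apply/mem_set; split; first by rewrite -kxy; exact: VJ.
  by move: vJ; rewrite JE => /set_mem[].
have uu : (uk x).1 = (uk y).1.
  have ux : (uk x).1 \in J x by rewrite JE; apply/mem_set.
  have uy : (uk y).1 \in J y by rewrite JE; apply/mem_set.
  by rewrite -(nth_index i0 ux) ic JJ nth_index.
have rr : r (hi (uk x).1) x = r (hi (uk x).1) y.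
  by have [_] := cVP _ Iu; apply; rewrite // cc -uu.
apply: mP => // t.
have := uP t; have := uP' t; rewrite -mxy -uu -rr.
have := ler_distD (e (r (hi (uk x).1) x) t) (e x t) (e y t).
rewrite (distrC (e x t) (e (r (hi (uk x).1) x) t)).
by move: (m x).+1%:R^-1 => d; lra.
Qed.

End Step.

(** [F] stays general in the induction because the points up to [u] with [F] are the points below
    [u] with [u :: F]. *)
Lemma sigma_isolated_downclosed (I : set S) : downclosed L I ->
  forall F : seq S, sigma_isolated (Y (I `|` [set` F])).
Proof.
move: I; apply: (downclosed_ind Lwo) => I dI IH F.
have [->|/set0P I0] := eqVneq I set0.
  rewrite set0U; apply: sigma_isolated_countable.
  have /countable_injP[f f_inj] := countable_hull g F.
  apply/countable_injP; exists (f \o inl) => x y /set_mem hx /set_mem hy fxy.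
  by have [] : inl x = inl y :> S by apply: f_inj => //; exact: mem_set.
apply: sigma_isolated_step => // u Iu.
suff -> : [set w | L w u] `|` [set` F] = initial_segment L u `|` [set` u :: F].
  exact: IH.
apply/seteqP; split=> w /=; rewrite inE.
- move=> [wu|wF]; last by right; rewrite wF orbT.
  by have [->|/eqP wu'] := eqVneq w u; [right|left].
- move=> [[wu _]|/orP[/eqP->|wF]]; [by left|by left; exact: wo_refl|by right].
Qed.

End Induction.

Lemma lindelof_sigma_scattered_discrete : lindelof_sigma X -> scattered X ->
  sigma_discrete X.
Proof.
move=> /lindelof_sigma_retractions[g [r rP]] /scattered_norm_separated[m mP].
apply: sigma_isolated_discrete.
have [L Lwo] := well_ordering_principle S.
have := sigma_isolated_downclosed rP mP Lwo (I := setT) (fun _ _ _ _ => I) [::].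
suff -> : closure (points (hull g (setT `|` [set` [::]]))) = [set: X] by [].
apply/seteqP; split=> // x _; apply: subset_closure; apply: hull_base; by left.
Qed.

End Pairing.

(** * Application to subspaces of [Cp R K] *)

Lemma set_type_cvg (T : topologicalType) (A : set T) (F : set_system (set_type A))
    (FF : Filter F) (x : set_type A) : (\val : A -> T) @ F --> (\val x : T) -> F --> x.
Proof.
move=> Fx W [_ [[V oV <-] Vx] VW]; apply: (filterS VW).
by apply: Fx; exact: open_nbhs_nbhs.
Qed.

Theorem mainTheorem8 (R : realType) (X : topologicalType)
    (eg : eberlein_grothendieck R X) (ls : lindelof_sigma X)
    (sc : scattered X) :
  sigma_discrete X.
Proof.
have [K [cK _ [E [f [h [fK hK cf ch]]]]]] := eg.
pose e (x : X) : K -> R := \val (\val (f x)).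
apply: (@lindelof_sigma_scattered_discrete R X K e) => //.
- by move=> x; exact: (set_mem (valP (\val (f x)))).
- move=> t x.
  apply: (@continuous_comp _ _ _ f (fun y : set_type E => \val (\val y) t)); first exact: cf.
  apply: (@continuous_comp _ _ _ (\val : E -> Cp R K) (fun y => \val y t)).
    exact: initial_continuous.
  apply: (@continuous_comp _ _ _ (\val : Cp R K -> {ptws K -> R}) (fun y => y t)).
    exact: initial_continuous.
  exact: (@proj_continuous K (fun=> R) t).
(* Pointwise convergence gives convergence of [f @ F] in the nested subspaces, and the continuous
   inverse [h] carries it back to [X]. *)
- move=> F FF x Fx.
  have fFx : f @ F --> f x.
    apply: set_type_cvg; apply: set_type_cvg.
    by apply/pointwise_cvgP => t; exact: Fx.
  have := cvg_comp _ _ fFx (ch (f x)); rewrite fK.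
  by apply: cvg_trans; apply: near_eq_cvg; apply: nearW => y /=; rewrite fK.
- move=> x y exy; rewrite -(fK x) -(fK y); congr h.
  apply: val_inj; apply: val_inj; exact/funext.
Qed.
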